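(* Consider the interconnected system, the local optimal control problems $\mathrm{OCP}_i(t)$ and the closed loop described in the context, with $x(0)\in\mathcal X$. Suppose that the finite-step small-gain assumption (F) of the context holds, that the Lipschitz estimate of the context holds, and that the problems $\mathrm{OCP}_i(t)$ are recursively feasible (feasible for all $t\in\mathbb Z_{\ge0}$ and all $i$). Let $\mathcal Z\subset\mathbb R^n$ be a compact set containing the closed-loop states $x(t)$ and all nominal prediction vectors $x^{\mathrm{nom},\star}(l|t)=(x_i^{\mathrm{nom},\star}(l|t))_{i=1}^\ell$, $l=0,\dots,M$, for all $t\in\mathbb Z_{\ge0}$. Define $$\rho(t):=\max_{i=1,\dots,\ell}\bigl(r_i^\star(M|t)+s_i(M|t)\bigr).$$ Then $x(t)\in\mathcal X$ and $u(t)\in\mathcal U$ for all $t\in\mathbb Z_{\ge0}$. Moreover, there exist small-gain scaling functions $\sigma_i\in\mathcal K_\infty$, $i=1,\dots,\ell$, (that is, $\sigma_i^{-1}\circ\gamma_{ij}\circ\sigma_j<\mathrm{id}$ for all $i$ and all $j\in\mathcal G_i^\gamma$) such that for $$V(x):=\max_{i=1,\dots,\ell}\sigma_i^{-1}(W_i(x_i))$$ there exist $\underline\alpha_V,\overline\alpha_V,\omega_V\in\mathcal K_\infty$ with $$\underline\alpha_V(\|x\|)\le V(x)\le\overline\alpha_V(\|x\|),\qquad |V(z)-V(z')|\le\omega_V(\|z-z'\|)\quad(z,z'\in\mathcal Z),$$ and there exist $\widehat\alpha,\widehat\gamma\in\mathcal K_\infty$ with $\widehat\alpha<\mathrm{id}$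 such that $$V(x(t+M))\le\max\bigl\{\widehat\alpha(V(x(t))),\widehat\gamma(\rho(t))\bigr\}\qquad\forall t\in\mathbb Z_{\ge0}.$$ (The estimate with $\omega_V$ is a consequence of the continuity of the functions $W_i$ and the compactness of $\mathcal Z$, not an independent assumption.)
   Context: Notation. $\|\cdot\|$ is the Euclidean norm, $\mathbb B_\Delta=\{e:\|e\|\le\Delta\}$, $\mathcal S\ominus\mathcal E=\{z: z+e\in\mathcal S\ \forall e\in\mathcal E\}$. For $v_{\mathcal N_i}=(v_j)_{j\in\mathcal N_i}$, $\|v_{\mathcal N_i}\|_{\mathcal N_i,\infty}=\max_{j\in\mathcal N_i}\|v_j\|$. Maxima over empty index sets are $0$. $\mathcal K$: continuous strictly increasing $\alpha:\mathbb R_{\ge0}\to\mathbb R_{\ge0}$ with $\alpha(0)=0$; $\mathcal K_\infty$: unbounded functions in $\mathcal K$; $\alpha<\mathrm{id}$ means $\alpha(s)<s$ for all $s>0$. System. $x_i(t+1)=g_i(x_i(t),x_{\mathcal N_i}(t),u_i(t))$, $i=1,\dots,\ell$, with constraint sets $\mathcal X_i\subseteq\mathbb R^{n_i}$, $\mathcal U_i\subseteq\mathbb R^{m_i}$, neighbor sets $\mathcal N_i\subset\{1,\dots,\ell\}\setminus\{i\}$, $x_{\mathcal N_i}=(x_j)_{j\in\mathcal N_i}$, $\mathcal X_{\mathcal N_i}=\prod_{j\in\mathcal N_i}\mathcal X_j$, $n=\sum_i n_i$, $\mathcal X=\prod_i\mathcal X_i$, $\mathcal U=\prod_i\mathcal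 U_i$, $x=(x_i)_i$, $u=(u_i)_i$, $g=(g_1,\dots,g_\ell)$, regarded as a map $g:\mathcal X\times\mathcal U\to\mathbb R^n$, $g(0,0)=0$; $g$ is $\mathcal K$-bounded: there are $\kappa_1,\kappa_2\in\mathcal K$ with $\|g(\xi,\mu)\|\le\kappa_1(\|\xi\|)+\kappa_2(\|\mu\|)$ on $\mathcal X\times\mathcal U$ (and likewise each $g_i$ on $\mathcal X_i\times\mathcal X_{\mathcal N_i}\times\mathcal U_i$). Lipschitz estimate: there are $L_{i,1},L_{i,2}>0$, $L_{i,3}\ge0$ with $$\|g_i(\xi_i,\xi_{\mathcal N_i},\mu_i)-g_i(\xi_i',\xi_{\mathcal N_i}',\mu_i')\|\le L_{i,1}\|\xi_i-\xi_i'\|+L_{i,2}\|\xi_{\mathcal N_i}-\xi'_{\mathcal N_i}\|_{\mathcal N_i,\infty}+L_{i,3}\|\mu_i-\mu_i'\|$$ on the constraint domain $\mathcal X_i\times\mathcal X_{\mathcal N_i}\times\mathcal U_i$. Assumption (F). $M\ge2$ is an integer; $W_i:\mathbb R^{n_i}\to\mathbb R_{\ge0}$ are continuous with $\underline\alpha_i(\|\xi_i\|)\le W_i(\xi_i)\le\overline\alpha_i(\|\xi_i\|)$, $\underline\alpha_i,\overline\alpha_i\in\mathcal K_\infty$; $\gamma_{ij}\in\mathcal K_\infty\cup\{0\}$ satisfy $\gamma_{i_1i_2}\circ\cdots\circ\gamma_{i_ri_1}<\mathrm{id}$ for every cycle of distinct indices, $r=1,\dots,\ell$; and there is an admissible finite-step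 feedback $q=(q_1,\dots,q_\ell):\mathcal X\to\mathcal U^M$, $q(\xi)=(q^{[0]}(\xi),\dots,q^{[M-1]}(\xi))$, with $W_i(x_i(M,\xi,u_q))\le\max_{j}\gamma_{ij}(W_j(\xi_j))$ for all $\xi\in\mathcal X$ and all $i$. Here $x(0,\xi,u_q)=\xi$, $x(l+1,\xi,u_q)=g(x(l,\xi,u_q),q^{[l]}(\xi))$ for $l=0,\dots,M-1$, and admissible means: for $l=1,\dots,M$, $x(l,\xi,u_q)\in\mathcal X$ for all $\xi\in\mathcal X$ and there is $\kappa_l\in\mathcal K$ with $\|x(l,\xi,u_q)\|\le\kappa_l(\|\xi\|)$ for all $\xi\in\mathcal X$. Put $\mathcal G_i^\gamma=\{j:\gamma_{ij}\not\equiv0\}$. The optimal control problems below use these $M,W_i,\gamma_{ij}$ and a weight $\lambda>0$. Packets. At time $t$ subsystem $i$ sends $(\bar x_i(l|t),\bar r_i(l|t))_{l=0}^{M-1}$ to the controllers of which it is a neighbor, where $\bar x_i(0|t)=x_i(t)$, $\bar r_i(0|t)=0$, and for $t\ge1$, $l=1,\dots,M-1$: $\bar x_i(l|t)=x_i^{\mathrm{nom},\star}(l+1|t-1)$, $\bar r_i(l|t)=r_i^\star(l+1|t-1)$. At $t=0$ packets (with nonnegative radii) are supplied by a feasible initialization procedure. At time $t$ controller $i$ knows the packets of all $j\in\mathcal N_i$ and the scalars $W_j(x_j(t))$, $j\in\mathcal G_i^\gamma$. Budget. $\mathcal B_i(l|t)=L_{i,2}\max_{j\in\mathcal N_i}\bar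 r_j(l|t)+d_i(l|t)$, $l=0,\dots,M-1$, where $d_i(l|t)=L_{i,2}\max_{j\in\mathcal N_i}\|\bar x_j(l|t)-\bar x_j(l+1|t-1)\|$ for $l\le M-2$ (for $t=0$, given nonnegative initialization values) and $d_i(M-1|t)=d_i^{\mathrm{ter}}(t)\ge0$ is prescribed. $\mathrm{OCP}_i(t)$: minimize over $(u_i(0|t),\dots,u_i(M-1|t))$ and $(r_i(1|t),\dots,r_i(M-1|t))$ the cost $\sum_{l=0}^{M-1}W_i(x_i^{\mathrm{nom}}(l|t))+\lambda\sum_{l=1}^{M-1}r_i(l|t)$ subject to: $x_i^{\mathrm{nom}}(0|t)=x_i(t)$; $x_i^{\mathrm{nom}}(l+1|t)=g_i(x_i^{\mathrm{nom}}(l|t),\bar x_{\mathcal N_i}(l|t),u_i(l|t))$ and $u_i(l|t)\in\mathcal U_i$ for $l=0,\dots,M-1$; $r_i(l|t)\ge0$ and $x_i^{\mathrm{nom}}(l|t)\in\mathcal X_i\ominus\mathbb B_{r_i(l|t)}$ for $l=1,\dots,M-1$; $r_i(l+1|t)\ge L_{i,1}r_i(l|t)+\mathcal B_i(l|t)$ for $l=0,\dots,M-2$, with $r_i(0|t):=0$ fixed; and $W_i(x_i^{\mathrm{nom}}(M|t))\le\max_{j\in\mathcal G_i^\gamma}\gamma_{ij}(W_j(x_j(t)))$. Optimizers carry a star; existence of a minimizer is understood whenever an optimizer is invoked. $r_i^\star(0|t)=0$ and $r_i^\star(M|t):=L_{i,1}r_i^\star(M-1|t)+\mathcal B_i(M-1|t)$.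 The closed loop applies $u_i(t)=u_i^\star(0|t)$ for every $i$. Mismatch quantities. For $l=0,\dots,M-1$: $p_i(l|t)=\|x_{\mathcal N_i}(t+l)-\bar x_{\mathcal N_i}(l|t)\|_{\mathcal N_i,\infty}$, $\delta_i^u(l|t)=\|u_i^\star(0|t+l)-u_i^\star(l|t)\|$, $\eta_i(l|t)=\max\{L_{i,2}p_i(l|t)+L_{i,3}\delta_i^u(l|t)-\mathcal B_i(l|t),0\}$; $s_i(0|t)=0$, $s_i(l+1|t)=L_{i,1}s_i(l|t)+\eta_i(l|t)$.
   Formalization: Feasibility of OCP_i(t) is taken to include that the received packet states x̄_j(l|t), j∈N_i, 1≤l≤M−1, lie in X_j, since g_i and its Lipschitz estimate are given only on X_i×X_{N_i}×U_i and the nominal dynamics would otherwise be undefined there. *)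

(* Defs.v *)
(* MathComp / MathComp-Analysis. *)
From mathcomp Require Export all_boot all_order all_algebra.
From mathcomp Require Export all_classical all_reals all_analysis.

Set Implicit Arguments.
Unset Strict Implicit.
Unset Printing Implicit Defensive.

Import Order.TTheory GRing.Theory Num.Theory.
Import numFieldNormedType.Exports.

Local Open Scope classical_set_scope.
Local Open Scope ring_scope.

(** * Comparison functions *)

(* Functions on the half-line [0, +oo[ are represented by functions R -> R whose
   values at negative reals are irrelevant. *)

Section comparison_functions.
Context {R : realType}.
Implicit Types a : R -> R.

Definition classK a :=
  [/\ a 0 = 0,
      {within `[0, +oo[, continuous a}
    & forall s t, 0 <= s -> s < t -> a s < a t].

Definition classKinf a :=
  classK a /\ (forall b, exists2 s, 0 <= s & b <= a s).

Definition zero_gain a := forall s, 0 <= s -> a s = 0.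

Definition lt_id a := forall s, 0 < s -> a s < s.

Definition Kinv a : R -> R := 'pinv_(fun=> 0) `[0, +oo[ a.

Fixpoint chain_gain (I : Type) (gam : I -> I -> R -> R) (i : I) (p : seq I)
    (k : I) : R -> R :=
  if p is j :: p' then gam i j \o chain_gain gam j p' k else gam i k.

(* A cycle of distinct indices i_1, ..., i_r is the sequence i_1 :: p. *)
Definition small_gain (I : eqType) (gam : I -> I -> R -> R) :=
  forall i p, uniq (i :: p) -> lt_id (chain_gain gam i p i).

End comparison_functions.

(** * Euclidean norm, balls, erosion *)

Section euclidean.
Context {R : realType}.

(* The library norm on matrices is the sup norm. *)
Definition enorm k (v : 'rV[R]_k) : R := Num.sqrt (\sum_j v 0 j ^+ 2).

Definition eball k (r : R) : set 'rV[R]_k := [set e | enorm e <= r].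

Definition pontryagin k (S E : set 'rV[R]_k) : set 'rV[R]_k :=
  [set z | forall e, E e -> S (z + e)].

End euclidean.

(** * Interconnected system *)

(* A point of R^n, with n the sum of the n_i, is a row vector made of blocks;
   its i-th block is [submxrow x i], and [\mxrow_i v i] stacks a family. *)

(* [dyn S i] is meaningful on X_i x X_{N_i} x U_i only; its values elsewhere are
   arbitrary. *)
Record network (R : realType) (ell : nat) := Network {
  dimx : 'I_ell -> nat;
  dimu : 'I_ell -> nat;
  Xc : forall i, set 'rV[R]_(dimx i);
  Uc : forall i, set 'rV[R]_(dimu i);
  nbr : 'I_ell -> {set 'I_ell};
  dyn : forall i : 'I_ell, 'rV[R]_(dimx i) ->
    (forall j : {j : 'I_ell | j \in nbr i}, 'rV[R]_(dimx (val j))) ->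
    'rV[R]_(dimu i) -> 'rV[R]_(dimx i) }.

Section system.
Context {R : realType} {ell : nat}.
Variable S : network R ell.

Definition state := 'rV[R]_(\sum_(i < ell) dimx S i).
Definition input := 'rV[R]_(\sum_(i < ell) dimu S i).
Definition family := forall j : 'I_ell, 'rV[R]_(dimx S j).
Definition nbstate (i : 'I_ell) :=
  forall j : {j : 'I_ell | j \in nbr S i}, 'rV[R]_(dimx S (val j)).

Definition at_nbr (i : 'I_ell) (v : family) : nbstate i := fun j => v (val j).
Arguments at_nbr : clear implicits.

Definition nbnorm i (v : nbstate i) : R := \big[Num.max/0]_j enorm (v j).

Definition nbdist i (v w : nbstate i) : R := nbnorm (fun j => v j - w j).

Definition XcN i : set (nbstate i) := [set v | forall j, Xc (v j)].

Definition Xset : set state := [set x | forall i, Xc (submxrow x i)].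
Definition Uset : set input := [set u | forall i, Uc (submxrow u i)].

Definition gmap (x : state) (u : input) : state :=
  \mxrow_i dyn (submxrow x i) (at_nbr i (submxrow x)) (submxrow u i).

Definition K_bounded :=
  (exists k1 k2, [/\ classK k1, classK k2 &
     forall x u, Xset x -> Uset u ->
       enorm (gmap x u) <= k1 (enorm x) + k2 (enorm u)]) /\
  (forall i, exists k1 k2 k3, [/\ classK k1, classK k2, classK k3 &
     forall x v u, Xc x -> XcN v -> Uc u ->
       enorm (@dyn _ _ S i x v u) <= k1 (enorm x) + k2 (nbnorm v) + k3 (enorm u)]).

Definition standing :=
  [/\ forall i, i \notin nbr S i, gmap 0 0 = 0 & K_bounded].

Definition lipschitz (L1 L2 L3 : 'I_ell -> R) :=
  forall i, [/\ 0 < L1 i, 0 < L2 i, 0 <= L3 i &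
    forall x v u x' v' u',
      Xc x -> XcN v -> Uc u -> Xc x' -> XcN v' -> Uc u' ->
      enorm (@dyn _ _ S i x v u - @dyn _ _ S i x' v' u') <=
        L1 i * enorm (x - x') + L2 i * nbdist v v' + L3 i * enorm (u - u')].

End system.

Arguments at_nbr {R ell S} i v.

(** * Data of the optimal control problems *)

Record ocp_data (R : realType) (ell : nat) (S : network R ell) := OcpData {
  hor : nat;
  W : forall i, 'rV[R]_(dimx S i) -> R;
  gam : 'I_ell -> 'I_ell -> R -> R;
  lam : R;
  L1 : 'I_ell -> R;
  L2 : 'I_ell -> R;
  L3 : 'I_ell -> R }.

Section finite_step.
Context {R : realType} {ell : nat} {S : network R ell}.
Variable P : ocp_data S.
Local Notation M := (hor P).

Definition active i j : bool := `[< ~ zero_gain (gam P i j) >].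

(* [q l] is the l-th component of the finite-step feedback, l < M. *)
Fixpoint predict (q : nat -> state S -> input S) (xi : state S) (l : nat) : state S :=
  if l is l'.+1 then gmap (predict q xi l') (q l' xi) else xi.

Definition admissible (q : nat -> state S -> input S) :=
  (forall l xi, (l < M)%N -> Xset xi -> Uset (q l xi)) /\
  (forall l, (0 < l <= M)%N ->
    (forall xi, Xset xi -> Xset (predict q xi l)) /\
    (exists2 k, classK k &
      forall xi, Xset xi -> enorm (predict q xi l) <= k (enorm xi))).

Record assumption_F : Prop := AssumptionF {
  F_hor : (2 <= M)%N;
  F_W_ge0 : forall i (x : 'rV_(dimx S i)), 0 <= W P x;
  F_W_cont : forall i, continuous (@W _ _ _ P i);
  F_W_bounds : forall i, exists a b, [/\ classKinf a, classKinf b &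
    forall x : 'rV_(dimx S i), a (enorm x) <= W P x <= b (enorm x)];
  F_gam : forall i j, classKinf (gam P i j) \/ zero_gain (gam P i j);
  F_small_gain : small_gain (gam P);
  F_feedback : exists2 q, admissible q &
    forall xi, Xset xi -> forall i,
      W P (submxrow (predict q xi M) i) <=
      \big[Num.max/0]_j gam P i j (W P (submxrow xi j)) }.

End finite_step.

(** * Signals of the distributed closed loop *)

(* Arguments are ordered: subsystem, time t, prediction index l.  Only the
   following prediction indices matter: l < M for [xbar], [rbar], [dist] and
   [ustar], and l <= M for [rstar].  [dist] is the packet-deviation term of the
   budget; its last entry l = M - 1 is a prescribed terminal allowance. *)
Record signals (R : realType) (ell : nat) (S : network R ell) := Signals {
  st : nat -> state S;
  xbar : forall i, nat -> nat -> 'rV[R]_(dimx S i);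
  rbar : 'I_ell -> nat -> nat -> R;
  dist : 'I_ell -> nat -> nat -> R;
  ustar : forall i, nat -> nat -> 'rV[R]_(dimu S i);
  rstar : 'I_ell -> nat -> nat -> R }.

Section closed_loop.
Context {R : realType} {ell : nat} {S : network R ell}.
Variables (P : ocp_data S) (C : signals S).
Local Notation M := (hor P).

Definition xst i t : 'rV[R]_(dimx S i) := submxrow (st C t) i.

Definition xbarN i t l : nbstate S i := at_nbr i (fun j => xbar C j t l).
Arguments xbarN : clear implicits.

Definition budget i t l : R :=
  L2 P i * (\big[Num.max/0]_(j in nbr S i) rbar C j t l) + dist C i t l.

Fixpoint xnom i t (u : nat -> 'rV[R]_(dimu S i)) (l : nat) : 'rV[R]_(dimx S i) :=
  if l is l'.+1 then dyn (@xnom i t u l') (xbarN i t l') (u l') else xst i t.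
Arguments xnom : clear implicits.

Definition ocp_cost i t (u : nat -> 'rV[R]_(dimu S i)) (r : nat -> R) : R :=
  \sum_(l < M) W P (xnom i t u l) + lam P * \sum_(1 <= l < M) r l.
Arguments ocp_cost : clear implicits.

(* [ocp_domain]: the predictions evaluate the partial map g_i at the received
   packet states, which must therefore lie in its domain.  The entry l = 0 is
   left out: it is the measured state, whose admissibility is to be proved. *)
Record ocp_feasible i t (u : nat -> 'rV[R]_(dimu S i)) (r : nat -> R) : Prop :=
  OcpFeasible {
  ocp_domain : forall l, (0 < l < M)%N -> XcN (xbarN i t l);
  ocp_input : forall l, (l < M)%N -> Uc (u l);
  ocp_rad0 : r 0%N = 0;
  ocp_rad_ge0 : forall l, (0 < l < M)%N -> 0 <= r l;
  ocp_state : forall l, (0 < l < M)%N ->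
    pontryagin (@Xc _ _ S i) (eball (r l)) (xnom i t u l);
  ocp_rad : forall l, (l.+1 < M)%N -> L1 P i * r l + budget i t l <= r l.+1;
  ocp_terminal : W P (xnom i t u M) <=
    \big[Num.max/0]_(j | active P i j) gam P i j (W P (xst j t)) }.
Arguments ocp_feasible : clear implicits.

Definition ocp_optimal i t (u : nat -> 'rV[R]_(dimu S i)) (r : nat -> R) :=
  ocp_feasible i t u r /\
  forall u' r', ocp_feasible i t u' r' -> ocp_cost i t u r <= ocp_cost i t u' r'.
Arguments ocp_optimal : clear implicits.

Definition recursively_feasible :=
  forall i t, exists (u : nat -> 'rV[R]_(dimu S i)) r, ocp_feasible i t u r.

Definition xnomstar i t l : 'rV[R]_(dimx S i) := xnom i t (ustar C i t) l.

Definition uapp t : input S := \mxrow_i ustar C i t 0.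

Record closed_loop : Prop := ClosedLoop {
  cl_dyn : forall t, st C t.+1 = gmap (st C t) (uapp t);
  cl_opt : forall i t, ocp_optimal i t (ustar C i t) (rstar C i t);
  cl_rstarM : forall i t,
    rstar C i t M = L1 P i * rstar C i t M.-1 + budget i t M.-1;
  cl_xbar0 : forall i t, xbar C i t 0 = xst i t;
  cl_rbar0 : forall i t, rbar C i t 0 = 0;
  cl_xbar : forall i t l, (0 < l < M)%N -> xbar C i t.+1 l = xnomstar i t l.+1;
  cl_rbar : forall i t l, (0 < l < M)%N -> rbar C i t.+1 l = rstar C i t l.+1;
  cl_rbar_init : forall i l, (0 < l < M)%N -> 0 <= rbar C i 0 l;
  cl_dist : forall i t l, (l.+1 < M)%N ->
    dist C i t.+1 l = L2 P i * nbdist (xbarN i t.+1 l) (xbarN i t l.+1);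
  cl_dist_init : forall i l, (l.+1 < M)%N -> 0 <= dist C i 0 l;
  cl_dist_ter : forall i t, 0 <= dist C i t M.-1 }.

Definition mismatch_p i t l : R :=
  nbdist (at_nbr i (fun j => xst j (t + l))) (xbarN i t l).

Definition mismatch_u i t l : R := enorm (ustar C i (t + l) 0 - ustar C i t l).

Definition excess i t l : R :=
  Num.max (L2 P i * mismatch_p i t l + L3 P i * mismatch_u i t l - budget i t l) 0.

Fixpoint sdev i t (l : nat) : R :=
  if l is l'.+1 then L1 P i * sdev i t l' + excess i t l' else 0.

Definition rho t : R := \big[Num.max/0]_i (rstar C i t M + sdev i t M).

End closed_loop.

Definition lyap (R : realType) (ell : nat) (S : network R ell) (P : ocp_data S)
    (sigma : 'I_ell -> R -> R) (x : state S) : R :=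
  \big[Num.max/0]_i Kinv (sigma i) (W P (submxrow x i)).

(* Main.v *)
Require Import Defs.
From mathcomp Require Import lra.
Set Implicit Arguments.
Unset Strict Implicit.
Unset Printing Implicit Defensive.
Import Order.TTheory GRing.Theory Num.Theory.
Import numFieldNormedType.Exports.
Local Open Scope classical_set_scope.
Local Open Scope ring_scope.

(* Scaling: sigma_i is the largest gain of a simple path issued from i, the
   argument being slightly enlarged, the more so the longer the path. Applying
   gam_ij to a path from j either lengthens it to a longer simple path from i, or
   closes a simple cycle at i, whose gain is below the identity with enough slack
   to absorb the enlargement; in both cases the result is strictly below sigma_i.

   Decrease: by the Lipschitz estimate, the true state at time t + l deviates
   from the nominal prediction by at most r(l|t) + s(l|t). At l = M the terminal
   constraint gives V(x^nom(M|t)) <= al(V(x(t))) with al < id, so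
   V(x(t + M)) <= al(V(x(t))) + omega(c rho(t)), and on the compact set Z this
   sum is dominated by a maximum. *)

(** * Comparison functions *)

Section comparison_functions.
Context {R : realType}.
Implicit Types (a b : R -> R) (s t : R).

Lemma classK_le a : classK a -> forall s t, 0 <= s -> s <= t -> a s <= a t.
Proof.
move=> [_ _ mono] s t s0; rewrite le_eqVlt => /predU1P[-> //|st].
exact/ltW/mono.
Qed.

Lemma classK_ge0 a : classK a -> forall s, 0 <= s -> 0 <= a s.
Proof. by move=> Ka s s0; have [<- _ _] := Ka; exact: classK_le. Qed.

Lemma classK_gt0 a : classK a -> forall s, 0 < s -> 0 < a s.
Proof. by move=> [a0 _ mono] s s0; rewrite -a0; exact: mono. Qed.

Lemma classK_inj a : classK a ->
  forall s t, 0 <= s -> 0 <= t -> a s = a t -> s = t.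
Proof.
move=> [_ _ mono] s t s0 t0 e; case: (ltgtP s t) => // st.
- by have := mono _ _ s0 st; rewrite e ltxx.
- by have := mono _ _ t0 st; rewrite e ltxx.
Qed.

Lemma Kinf_surj a : classKinf a ->
  forall y, 0 <= y -> exists2 s, 0 <= s & a s = y.
Proof.
move=> [Ka unb] y y0; have [b b0 yb] := unb y; have [a0 cont _] := Ka.
have [||c] := @IVT R a 0 b y b0.
- apply: continuous_subspaceW cont => x /=.
  by rewrite !in_itv/= => /andP[-> _].
- by rewrite a0 min_l ?max_r ?y0//; exact: classK_ge0.
by rewrite in_itv/= => /andP[c0 _] <-; exists c.
Qed.

(** A monotone function can only jump, and a jump would skip a value, so surjectivity stands in for
    continuity. For maxima, compositions and inverses the preimages are explicit, which avoids
    limits. *)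
Lemma Kinf_intro a : a 0 = 0 -> (forall s t, 0 <= s -> s < t -> a s < a t) ->
  (forall y, 0 <= y -> exists2 s, 0 <= s & a s = y) -> classKinf a.
Proof.
move=> a0 mono surj; split; last first.
  move=> b; have [s s0 as_] := surj (Num.max 0 b) ltac:(by rewrite le_max lexx).
  by exists s => //; rewrite as_ le_max lexx orbT.
split=> //.
have reflect_lt s t : 0 <= s -> 0 <= t -> a s < a t -> s < t.
  move=> s0 t0 st; rewrite ltNge le_eqVlt; apply/negP => /predU1P[ts|ts].
    by rewrite ts ltxx in st.
  by have := lt_trans st (mono _ _ t0 ts); rewrite ltxx.
have a_ge0 s : 0 <= s -> 0 <= a s.
  rewrite le_eqVlt => /predU1P[<-|s0]; first by rewrite a0.
  by rewrite ltW// -a0 mono.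
apply/subspace_continuousP => x /=; rewrite in_itv/= andbT => x0.
apply/cvgrPdist_lt => e e0.
(* Preimages of [a x + e / 2] and [a x - e / 2] bracket [x]; between them monotonicity keeps [a]
   within [e] of [a x]. *)
have [xp xp0 axp] := surj (a x + e / 2) ltac:(have := a_ge0 _ x0; lra).
have xxp : x < xp by apply: reflect_lt => //; rewrite axp; lra.
have upper z : 0 <= z -> z < xp -> a z < a x + e.
  by move=> z0 /(mono _ _ z0); rewrite axp; lra.
suff: \forall z \near within `[0, +oo[%classic (nbhs x),
    a x - e < a z /\ z < xp /\ 0 <= z.
  apply: filterS => z [H1 [H2 H3]].
  by rewrite ltr_distlC H1 upper.
(* A negative level has no preimage, but then [0 <= a z] already gives the lower bound. *)
have [neg|pos] := ltP (a x - e / 2) 0.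
  near=> z; have z0 : 0 <= z.
    have : `[0, +oo[%classic z by near: z; exact: withinT.
    by rewrite /= in_itv/= andbT.
  split; first by have := a_ge0 _ z0; lra.
  split=> //; near: z; apply: cvg_within; exact: lt_nbhsl.
have [xm xm0 axm] := surj _ pos.
have xmx : xm < x by apply: reflect_lt => //; rewrite axm; lra.
near=> z; have z0 : 0 <= z.
  have : `[0, +oo[%classic z by near: z; exact: withinT.
  by rewrite /= in_itv/= andbT.
have xmz : xm < z by near: z; apply: cvg_within; exact: lt_nbhsr.
split; first by have := mono _ _ xm0 xmz; rewrite axm; lra.
split=> //; near: z; apply: cvg_within; exact: lt_nbhsl.
Unshelve. all: by end_near. Qed.

(* Constant extension to the negative reals, where the values of comparison
   functions are junk, turns relative continuity into plain continuity. *)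
Lemma classK_continuous a : classK a -> continuous (fun s => a (Num.max 0 s)).
Proof.
move=> [_ /subspace_continuousP cont _] s.
have m0 : 0 <= Num.max 0 s by rewrite le_max lexx.
have /cont ca : `[0, +oo[%classic (Num.max 0 s) by rewrite /= in_itv/= m0.
apply: cvg_comp ca => U; rewrite /= /within/= => nU.
have cm : {for s, continuous (fun x : R^o => Num.max (0 : R^o) x)}.
  by apply: (@continuous_max R R^o (cst 0) id); [exact: cvg_cst|exact: cvg_id].
have nH : \forall z \near s, `[0, +oo[%classic (Num.max 0 z) -> U (Num.max 0 z).
  exact: cm _ nU.
apply: (@filterS _ (nbhs s) _ _ _ _ nH) => z /=; apply.
by rewrite in_itv/= andbT le_max lexx.
Qed.

(** Complements [Kinf_intro] for functions such as sums, whose preimages have no closed form: the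
    intermediate value theorem supplies them. *)
Lemma continuous_Kinf a : a 0 = 0 ->
  (forall s t, 0 <= s -> s < t -> a s < a t) ->
  (forall s, 0 <= s -> exists2 t, 0 <= t & s <= a t) ->
  continuous (fun s => a (Num.max 0 s)) -> classKinf a.
Proof.
move=> a0 mono unb cont; apply: Kinf_intro => // y y0.
have [b b0 yb] := unb y y0.
have [||c] := @IVT R (fun s => a (Num.max 0 s)) 0 b y b0.
- exact: continuous_subspaceT.
- have aby : 0 <= a b by exact: le_trans yb.
  by rewrite maxxx (max_r b0) a0 (min_l aby) (max_r aby) y0.
by rewrite in_itv/= => /andP[c0 _]; rewrite max_r// => <-; exists c.
Qed.

(** * Closure properties of class K_oo *)

Lemma Kinf_id : classKinf (@id R).
Proof. by apply: Kinf_intro => // y y0; exists y. Qed.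

Lemma Kinf_comp a b : classKinf a -> classKinf b -> classKinf (a \o b).
Proof.
move=> Ka Kb; have [[a0 _ amono] _] := Ka; have [[b0 _ bmono] _] := Kb.
apply: Kinf_intro => /=; first by rewrite b0 a0.
- move=> s t s0 st; apply: amono; [apply: classK_ge0 Kb.1 _ _ => //|exact: bmono].
- move=> y y0; have [u u0 <-] := Kinf_surj Ka y0.
  by have [s s0 <-] := Kinf_surj Kb u0; exists s.
Qed.

Lemma Kinf_scale (c : R) : 0 < c -> classKinf ( *%R c).
Proof.
move=> c0; apply: Kinf_intro; first by rewrite mulr0.
- by move=> s t _; rewrite ltr_pM2l.
- move=> y y0; exists (c^-1 * y); last by rewrite mulVKf// gt_eqF.
  by rewrite mulr_ge0// invr_ge0 ltW.
Qed.

Lemma Kinf_max a b : classKinf a -> classKinf b ->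
  classKinf (fun s => Num.max (a s) (b s)).
Proof.
move=> Ka Kb; have [[a0 _ amono] _] := Ka; have [[b0 _ bmono] _] := Kb.
apply: Kinf_intro; first by rewrite a0 b0 max_r.
- by move=> s t s0 st; rewrite gt_max !lt_max amono// bmono// orbT.
move=> y y0; have [s s0 sy] := Kinf_surj Ka y0; have [t t0 ty] := Kinf_surj Kb y0.
have [st|/ltW ts] := leP s t.
- by exists s => //; rewrite sy max_l// -ty; apply: classK_le Kb.1 _ _ _ _.
- by exists t => //; rewrite ty max_r// -sy; apply: classK_le Ka.1 _ _ _ _.
Qed.

Lemma Kinf_min a b : classKinf a -> classKinf b ->
  classKinf (fun s => Num.min (a s) (b s)).
Proof.
move=> Ka Kb; have [[a0 _ amono] _] := Ka; have [[b0 _ bmono] _] := Kb.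
apply: Kinf_intro; first by rewrite a0 b0 min_r.
- by move=> s t s0 st; rewrite lt_min !gt_min amono// bmono// orbT.
move=> y y0; have [s s0 sy] := Kinf_surj Ka y0; have [t t0 ty] := Kinf_surj Kb y0.
have [st|/ltW ts] := leP s t.
- by exists t => //; rewrite ty min_r// -sy; apply: classK_le Ka.1 _ _ _ _.
- by exists s => //; rewrite sy min_l// -ty; apply: classK_le Kb.1 _ _ _ _.
Qed.

Lemma Kinf_add a b : classKinf a -> classKinf b -> classKinf (fun s => a s + b s).
Proof.
move=> Ka Kb; have [[a0 _ amono] unb] := Ka; have [[b0 _ bmono] _] := Kb.
apply: continuous_Kinf; first by rewrite a0 b0 addr0.
- by move=> s t s0 st; rewrite ltrD ?amono ?bmono.
- move=> s s0; have [t t0 st] := unb s; exists t => //.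
  by rewrite (le_trans st)// lerDl; exact: classK_ge0 Kb.1 _ t0.
- by move=> s; apply: cvgD; apply: classK_continuous; [exact: Ka.1|exact: Kb.1].
Qed.

Definition mid a b := fun s => (a s + b s) / 2.

Lemma Kinf_mid a b : classKinf a -> classKinf b -> classKinf (mid a b).
Proof.
move=> Ka Kb; have -> : mid a b = *%R 2^-1 \o (fun s => a s + b s).
  by apply/funext => s; rewrite /mid /= mulrC.
by apply: Kinf_comp (Kinf_add Ka Kb); apply: Kinf_scale; rewrite invr_gt0.
Qed.

(** * Inverses of K_oo functions *)

Section inverse.
Variable a : R -> R.
Hypothesis Ka : classKinf a.

Let in_range y : 0 <= y -> y \in a @` `[0, +oo[%classic.
Proof.
move=> y0; apply/mem_set; have [s s0 <-] := Kinf_surj Ka y0.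
by exists s => //=; rewrite in_itv/= s0.
Qed.

Lemma Kinv_ge0 y : 0 <= y -> 0 <= Kinv a y.
Proof.
move=> /in_range/set_mem ry.
have inj : {in `[0, +oo[%classic &, injective a}.
  move=> s t /set_mem/=; rewrite in_itv/= andbT => s0 /set_mem/=.
  by rewrite in_itv/= andbT => t0; exact: classK_inj Ka.1 _ _ s0 t0.
have : ('pinv_(fun=> 0) `[0, +oo[ a @` (a @` `[0, +oo[)) (Kinv a y).
  by exists y.
by rewrite injpinv_image//= in_itv/= andbT.
Qed.

Lemma KinvK y : 0 <= y -> a (Kinv a y) = y.
Proof. by move=> /in_range; exact: pinvK. Qed.

Lemma KinvKK s : 0 <= s -> Kinv a (a s) = s.
Proof.
move=> s0; have as0 := classK_ge0 Ka.1 s0.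
by apply: (classK_inj Ka.1) => //; [exact: Kinv_ge0|exact: KinvK].
Qed.

Lemma Kinf_Kinv : classKinf (Kinv a).
Proof.
have [[a0 _ _] _] := Ka.
apply: Kinf_intro; first by rewrite -{1}a0 KinvKK.
- move=> s t s0 st; have t0 := le_trans s0 (ltW st).
  rewrite ltNge; apply/negP => /(classK_le Ka.1 (Kinv_ge0 t0)).
  by rewrite !KinvK// leNgt st.
- move=> y y0; exists (a y); first exact: classK_ge0 Ka.1 _ y0.
  exact: KinvKK.
Qed.

Lemma Kinv_lt y s : 0 <= y -> 0 <= s -> y < a s -> Kinv a y < s.
Proof.
move=> y0 s0 ys; rewrite -(KinvKK s0).
by have [[_ _ mono] _] := Kinf_Kinv; exact: mono.
Qed.

Lemma lt_Kinv y s : 0 <= y -> 0 <= s -> a s < y -> s < Kinv a y.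
Proof.
move=> y0 s0 ys; rewrite -(KinvKK s0).
by have [[_ _ mono] _] := Kinf_Kinv; apply: mono => //; exact: classK_ge0 Ka.1 _ s0.
Qed.

End inverse.

(** * Gains: K_oo functions together with zero *)

Definition gain a := classKinf a \/ zero_gain a.

Lemma gain0 a : gain a -> a 0 = 0.
Proof. by case=> [[[]]|/(_ 0 (lexx 0))]. Qed.

Lemma gain_le a : gain a -> forall s t, 0 <= s -> s <= t -> a s <= a t.
Proof.
case=> [[Ka _]|za] s t s0 st; first exact: classK_le.
by rewrite !za// (le_trans s0).
Qed.

Lemma gain_ge0 a : gain a -> forall s, 0 <= s -> 0 <= a s.
Proof. by move=> ga s s0; rewrite -(gain0 ga); exact: gain_le. Qed.

Lemma gain_comp a b : gain a -> gain b -> gain (a \o b).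
Proof.
move=> ga [Kb|zb]; last by right=> s s0 /=; rewrite zb// gain0.
case: ga => [Ka|za]; first by left; exact: Kinf_comp.
by right=> s s0 /=; rewrite za//; exact: classK_ge0 Kb.1 _ s0.
Qed.

(** Values at negative arguments are arbitrary, so two gains that agree on the half-line must be
    interchangeable. *)
Lemma gain_eq a b : gain a -> (forall s, 0 <= s -> a s = b s) -> gain b.
Proof.
case=> [Ka|za] ab; last by right=> s s0; rewrite -ab// za.
have [[a0 _ mono] _] := Ka; left; apply: Kinf_intro.
- by rewrite -ab.
- by move=> s t s0 st; rewrite -!ab ?mono// (le_trans s0)// ltW.
- by move=> y /(Kinf_surj Ka)[s s0 <-]; exists s => //; rewrite ab.
Qed.

Lemma gain_max a b : gain a -> gain b -> gain (fun s => Num.max (a s) (b s)).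
Proof.
case=> [Ka|za] [Kb|zb].
- by left; exact: Kinf_max.
- apply: (@gain_eq a); first by left.
  by move=> s s0; rewrite zb// max_l//; exact: classK_ge0 Ka.1 _ s0.
- apply: (@gain_eq b); first by left.
  by move=> s s0; rewrite za// max_r//; exact: classK_ge0 Kb.1 _ s0.
- by right=> s s0; rewrite za// zb// maxxx.
Qed.

Lemma gain_bigmax (I : Type) (r : seq I) (P : pred I) (F : I -> R -> R) :
  (forall i, P i -> gain (F i)) ->
  gain (fun s => \big[Num.max/0]_(i <- r | P i) F i s).
Proof.
move=> gF; elim: r => [|i r IH]; first by right=> s _; rewrite big_nil.
case Pi: (P i).
  by apply: gain_eq (gain_max (gF _ Pi) IH) _ => s _; rewrite big_cons Pi.
by apply: gain_eq IH _ => s _; rewrite big_cons Pi.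
Qed.

Lemma gain_Kinf a s : gain a -> 0 <= s -> 0 < a s -> classKinf a.
Proof. by case=> // za s0; rewrite za// ltxx. Qed.

(** A fold of binary minima starting from [b], which covers the empty family. The last clause keeps
    strict lower bounds; [common_expansion] needs it to stay above the identity. *)
Lemma Kinf_lower (I : finType) (F : I -> R -> R) b :
  classKinf b -> (forall i, classKinf (F i)) ->
  exists a, [/\ classKinf a, forall i s, a s <= F i s &
    forall s t, t < b s -> (forall i, t < F i s) -> t < a s].
Proof.
move=> Kb KF; suff [a [Ka aF aG]] : exists a, [/\ classKinf a,
    forall i s, i \in enum I -> a s <= F i s &
    forall s t, t < b s -> (forall i, t < F i s) -> t < a s].
  by exists a; split=> // i s; apply: aF; rewrite mem_enum.
elim: (enum I) => [|i r [a [Ka aF aG]]]; first by exists b.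
exists (fun s => Num.min (F i s) (a s)); split; first exact: Kinf_min.
  move=> j s; rewrite inE => /predU1P[->|jr]; first by rewrite ge_min lexx.
  by rewrite ge_min aF ?orbT.
by move=> s t tb tF; rewrite lt_min tF aG.
Qed.

Lemma Kinf_upper (I : finType) (F : I -> R -> R) :
  (forall i, classKinf (F i)) ->
  exists2 a, classKinf a & forall i s, F i s <= a s.
Proof.
move=> KF; suff [a Ka aF] : exists2 a, classKinf a &
    forall i s, i \in enum I -> F i s <= a s.
  by exists a => // i s; apply: aF; rewrite mem_enum.
elim: (enum I) => [|i r [a Ka IH]]; first by exists id; first exact: Kinf_id.
exists (fun s => Num.max (F i s) (a s)); first exact: Kinf_max.
move=> j s; rewrite inE => /predU1P[->|jr]; first by rewrite le_max lexx.
by rewrite le_max IH ?orbT.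
Qed.

Lemma bigmax0_attained (I : finType) (P : pred I) (F : I -> R) :
  \big[Num.max/0]_(i | P i) F i = 0 \/
  exists2 i, P i & \big[Num.max/0]_(i | P i) F i = F i.
Proof.
apply: (big_ind (fun x => x = 0 \/ exists2 i, P i & x = F i)).
- by left.
- by move=> x y Hx Hy; rewrite maxEle; case: ifP.
- by move=> i Pi; right; exists i.
Qed.

End comparison_functions.

(** * Majorants of class K_oo *)

Section majorants.
Context {R : realType}.

(* The K_oo majorant is s plus the infimum of all affine majorants, which is
   concave, hence continuous. *)
Lemma Kinf_majorant (E : set (R * R)) :
  (forall p, E p -> 0 <= p.1) ->
  (forall e, 0 < e -> exists2 b, 0 <= b & forall p, E p -> p.2 <= e + b * p.1) ->
  exists2 om, classKinf om & forall p, E p -> p.2 <= om p.1.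
Proof.
move=> E_ge0 E_aff.
pose maj := [set c : R * R | [/\ 0 <= c.1, 0 <= c.2 &
  forall p, E p -> p.2 <= c.1 + c.2 * p.1]].
pose vals s := [set c.1 + c.2 * s | c in maj].
pose w s := inf (vals s).
have majP e : 0 < e -> exists2 b, 0 <= b & maj (e, b).
  by move=> e0; have [b b0 Hb] := E_aff e e0; exists b => //; split=> //=; exact: ltW.
have vals0 s : 0 <= s -> lbound (vals s) 0.
  by move=> s0 _ [c [c1 c2 _] <-]; rewrite addr_ge0// mulr_ge0.
have valsN s : vals s !=set0.
  by have [b _ mb] := majP 1 ltr01; exists (1 + b * s), (1, b).
have vals_inf s : 0 <= s -> has_inf (vals s).
  by move=> s0; split=> //; exists 0; exact: vals0.
have w_le s c : 0 <= s -> maj c -> w s <= c.1 + c.2 * s.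
  by move=> s0 mc; apply: ge_inf; [exists 0; exact: vals0|exists c].
have le_w s m : (forall c, maj c -> m <= c.1 + c.2 * s) -> m <= w s.
  by move=> H; apply: lb_le_inf => // _ [c mc <-]; exact: H.
have w_ge0 s : 0 <= s -> 0 <= w s.
  by move=> s0; apply: le_w => c mc; apply: (vals0 s) => //; exists c.
(* At 0 only the intercept counts, and [E_aff] makes it arbitrarily small. *)
have w0 : w 0 = 0.
  apply/eqP; rewrite eq_le w_ge0// andbT; apply/ler_addgt0Pr => e e0.
  by have [b b0 /(w_le 0 _ (lexx 0))] := majP e e0; rewrite mulr0 addr0 add0r.
have w_mono s t : 0 <= s -> s <= t -> w s <= w t.
  move=> s0 st; apply: le_w => c mc; apply: le_trans (w_le s c s0 mc) _.
  by case: mc => _ c2 _; rewrite lerD2l ler_wpM2l.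
(* Concavity in the only form needed: the graph lies above its chords from the origin. It bounds [w]
   from below to the left of a point. *)
have w_slope s t : 0 < t -> 0 <= s -> s <= t -> s / t * w t <= w s.
  move=> t0 s0 st; apply: le_w => c mc.
  have [c1 c2 _] := mc.
  have := w_le t c (ltW t0) mc.
  have q0 : 0 <= s / t by rewrite divr_ge0// ltW.
  have q1 : s / t <= 1 by rewrite ler_pdivrMr// mul1r.
  move=> /(ler_wpM2l q0)/le_trans; apply.
  rewrite mulrDr mulrCA divfK ?gt_eqF// lerD2r.
  by rewrite ler_piMl.
have m_ge0 x : 0 <= Num.max 0 x :> R by rewrite le_max lexx.
have cmax : continuous (fun x : R => Num.max 0 x).
  by have := classK_continuous (@Kinf_id R).1.
have wc : continuous (fun x : R => w (Num.max 0 x)).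
  move=> x; apply/cvgrPdist_lt => e e0.
  (* An infimum of continuous functions is upper semicontinuous: a nearly optimal affine majorant
     stays below the threshold near [x]. *)
  have upper : \forall z \near x, w (Num.max 0 z) < w (Num.max 0 x) + e.
    have [_ [c mc <-] /= Hc] := inf_adherent e0 (vals_inf _ (m_ge0 x)).
    have cc : (fun z => c.1 + c.2 * Num.max 0 z) z @[z --> x] -->
        c.1 + c.2 * Num.max 0 x.
      by apply: cvgD; [exact: cvg_cst|apply: cvgM; [exact: cvg_cst|exact: cmax]].
    near=> z; apply: le_lt_trans (w_le _ c (m_ge0 z) mc) _.
    by near: z; exact: cvgr_lt cc _ Hc.
  have lower : \forall z \near x, w (Num.max 0 x) - e < w (Num.max 0 z).
    have [x0|x0] := leP x 0.
      near=> z; rewrite w0 sub0r.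
      by apply: lt_le_trans (w_ge0 _ (m_ge0 z)); rewrite oppr_lt0.
    have cc : (fun z => z / x * w x) z @[z --> x] --> x / x * w x.
      apply: cvgM; last exact: cvg_cst.
      by apply: cvgM; [exact: cvg_id|exact: cvg_cst].
    have Hlt : w x - e < x / x * w x by rewrite divff ?gt_eqF// mul1r; lra.
    near=> z.
    have z0 : 0 < z by near: z; exact: lt_nbhsr.
    have -> : Num.max 0 z = z by exact/max_r/ltW.
    have [zx|/ltW xz] := leP z x.
      by apply: lt_le_trans (w_slope _ _ x0 (ltW z0) zx); near: z; exact: cvgr_gt cc _ Hlt.
    by apply: lt_le_trans (w_mono _ _ (ltW x0) xz); lra.
  near=> z; rewrite ltr_distlC; apply/andP; split; near: z => //.
exists (fun s => w s + s).
  apply: continuous_Kinf.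
  - by rewrite w0 addr0.
  - by move=> s t s0 st; rewrite ler_ltD// w_mono// ltW.
  - by move=> s s0; exists s => //; rewrite lerDr w_ge0.
  - by move=> x; apply: cvgD; [exact: wc|exact: cmax].
move=> p Ep; rewrite (@le_trans _ _ (w p.1))//; last by rewrite lerDl E_ge0.
by apply: le_w => c [_ _]; apply.
Unshelve. all: by end_near. Qed.

(** Affine majorants come from compactness. Where [d < e] the intercept suffices; the part of [A]
    with [e <= d] is compact and avoids the zeros of [s], so the maximum of [d] divided by the
    minimum of [s] on that part is a valid slope. *)
Lemma compact_majorant (T : topologicalType) (A : set T) (d s : T -> R) :
  compact A -> continuous d -> continuous s ->
  (forall x, A x -> 0 <= s x) -> (forall x, A x -> s x = 0 -> d x <= 0) ->
  exists2 om, classKinf om & forall x, A x -> d x <= om (s x).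
Proof.
move=> cA cd cs s_ge0 sd0.
have [||om Kom Hom] := @Kinf_majorant [set (s x, d x) | x in A].
- by move=> _ [x Ax <-]; exact: s_ge0.
- move=> e e0; pose A' := A `&` [set x | e <= d x].
  have cA' : compact A'.
    apply: compact_closedI => //.
    have -> : [set x | e <= d x] = d @^-1` [set y | e <= y] by [].
    by apply: closed_comp => [x _|]; [exact: cd|exact: closed_ge].
  have [[x0 A'x0]|noA'] := pselect (A' !=set0); last first.
    exists 0 => // _ [x Ax <-] /=; rewrite mul0r addr0 leNgt; apply/negP => ex.
    by apply: noA'; exists x; split=> //=; exact: ltW.
  have [c /set_mem [Ac ec] Hc] := compact_EVT_min (ex_intro _ x0 A'x0) cA'
    (continuous_subspaceT cs).
  have [D /set_mem AD HD] := compact_EVT_max (ex_intro _ x0 A'x0.1) cA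
    (continuous_subspaceT cd).
  have sc0 : 0 < s c.
    rewrite lt_neqAle s_ge0// andbT eq_sym; apply/eqP => /(sd0 _ Ac).
    by move=> /(lt_le_trans (lt_le_trans e0 ec)); rewrite ltxx.
  have dD0 : 0 <= d D.
    apply: le_trans (HD x0 (mem_set A'x0.1)).
    by rewrite (le_trans (ltW e0))//; exact: A'x0.2.
  exists (d D / s c); first by rewrite divr_ge0// ltW.
  move=> _ [x Ax <-] /=.
  have [xe|ex] := ltP (d x) e.
    by rewrite (le_trans (ltW xe))// lerDl mulr_ge0 ?s_ge0// divr_ge0// ltW.
  have scx : s c <= s x by apply: Hc; apply/mem_set; split.
  apply: le_trans (HD x (mem_set Ax)) _.
  rewrite (@le_trans _ _ (d D / s c * s x))//; last by rewrite lerDr ltW.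
  by rewrite mulrAC -mulrA ler_peMr// ler_pdivlMr// mul1r.
by exists om => // x Ax; apply: (Hom (s x, d x)); exists x.
Qed.

End majorants.

(** * Small-gain scaling *)

Section small_gain.
Context {R : realType} {I : finType}.
Variable gam : I -> I -> R -> R.
Hypothesis gam_gain : forall i j, gain (gam i j).
Hypothesis sg : small_gain gam.

(** Unlike [chain_gain], it has no separate endpoint, so the path of length 0 is allowed and has
    gain [id]. *)
Fixpoint path_gain (i : I) (p : seq I) : R -> R :=
  if p is j :: p' then gam i j \o path_gain j p' else id.

Lemma path_gainP i p : gain (path_gain i p).
Proof.
elim: p i => [|j p IH] i /=; first by left; exact: Kinf_id.
by apply: gain_comp; [exact: gam_gain|exact: IH].
Qed.

(** Cuts a path at a vertex [k]; when [k] is the origin [i], the first factor is the gain of a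
    cycle. *)
Lemma path_gain_rcons_cat i p k q :
  path_gain i (rcons p k ++ q) = chain_gain gam i p k \o path_gain k q.
Proof. by elim: p i => [|j p IH] i //=; rewrite IH. Qed.

(** Strictness leaves room to enlarge the argument: for nonzero [a], take [b] followed by the
    inverse of [a]. *)
Lemma expansion (a b : R -> R) : gain a -> gain b ->
  (forall r, 0 < r -> a r < b r \/ a r = 0) ->
  exists eta : R -> R, [/\ classKinf eta, forall r, 0 < r -> r < eta r &
    forall r, 0 <= r -> a (eta r) <= b r].
Proof.
move=> ga gb lt_ab; case: (ga) => [Ka|za]; last first.
  exists ( *%R 2); split; first exact: Kinf_scale.
    by move=> r r0; lra.
  by move=> r r0; rewrite za ?mulr_ge0//; exact: gain_ge0.
have b_gt r : 0 < r -> a r < b r.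
  move=> r0; have [//|ar0] := lt_ab r r0.
  by have := classK_gt0 Ka.1 r0; rewrite ar0 ltxx.
have Kb : classKinf b.
  apply: (@gain_Kinf _ _ 1) => //.
  by apply: le_lt_trans (b_gt 1 ltr01); exact: gain_ge0.
have b_ge0 r : 0 <= r -> 0 <= b r by exact: gain_ge0.
exists (Kinv a \o b); split; first by apply: Kinf_comp => //; exact: Kinf_Kinv.
  move=> r r0; apply: lt_Kinv => //; [exact/b_ge0/ltW|exact: ltW|exact: b_gt].
by move=> r r0 /=; rewrite KinvK// b_ge0.
Qed.

(** The minimum of the individual expansions and of [2 r] serves all indices at once, because gains
    are monotone. *)
Lemma common_expansion (K : finType) (P : pred K) (a b : K -> R -> R) :
  (forall k, P k -> [/\ gain (a k), gain (b k) &
     forall r, 0 < r -> a k r < b k r \/ a k r = 0]) ->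
  exists eta : R -> R, [/\ classKinf eta, forall r, 0 < r -> r < eta r &
    forall k, P k -> forall r, 0 <= r -> a k (eta r) <= b k r].
Proof.
move=> Hab.
have K2 : classKinf ( *%R (2 : R)) by exact: Kinf_scale.
have /choice[F HF] : forall k, exists eta : R -> R, [/\ classKinf eta,
    forall r, 0 < r -> r < eta r &
    P k -> forall r, 0 <= r -> a k (eta r) <= b k r].
  move=> k; have [Pk|_] := boolP (P k).
    have [ga gb lt_ab] := Hab k Pk.
    by have [eta [Keta gt_eta le_eta]] := expansion ga gb lt_ab; exists eta.
  by exists ( *%R 2); split=> // r r0; lra.
have [eta [Keta le_eta lt_eta]] := Kinf_lower K2 (fun k => let: And3 H _ _ := HF k in H).
exists eta; split=> // [r r0|k Pk r r0].
  apply: lt_eta => [|k]; first by lra.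
  by have [_ + _] := HF k; apply.
have [_ _ /(_ Pk r r0)] := HF k; apply: le_trans.
have [ga _ _] := Hab k Pk; apply: gain_le => //; exact: classK_ge0 Keta.1 _ _.
Qed.

(** Each rung halves the remaining distance to [eta], so the rungs increase strictly without ever
    reaching it. *)
Fixpoint ladder (eta : R -> R) (n : nat) : R -> R :=
  if n is n'.+1 then mid (ladder eta n') eta else id.

Lemma ladder_Kinf eta n : classKinf eta -> classKinf (ladder eta n).
Proof. by move=> Ke; elim: n => [|n IH]; [exact: Kinf_id|exact: Kinf_mid]. Qed.

Lemma ladder_lt eta n r : r < eta r -> ladder eta n r < eta r.
Proof. by move=> re; elim: n => [|n IH] //=; rewrite /mid; lra. Qed.

Lemma ladder_ltS eta n r : r < eta r -> ladder eta n r < ladder eta n.+1 r.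
Proof. by move=> /(ladder_lt n) /=; rewrite /mid; lra. Qed.

Lemma ladder_ge eta n r : r < eta r -> r <= ladder eta n r.
Proof.
move=> re; elim: n => [|n IH] //; apply: le_trans IH _.
exact/ltW/ladder_ltS.
Qed.

(* [sigma i r] is the largest gain of a simple path p issued from i, applied to
   [ladder eta (size p) r]. The ladder strictly grows with the length of the
   path, which makes the scaled gains strictly smaller than the identity, but
   stays below [eta], so that closing a cycle still does not pay off. *)
Lemma small_gain_scaling :
  exists2 sigma : I -> R -> R, forall i, classKinf (sigma i) &
    forall i j r, 0 < r -> gam i j (sigma j r) < sigma i r.
Proof.
(* A triple [(i, (p, q))] encodes a simple cycle [p] at [i] and a simple path [q] from [i]. Bounded
   sequences make these triples a finite type, so a single [eta] serves them all. *)
pose K := (I * (#|I|.-bseq I * #|I|.-bseq I))%type.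
pose P (k : K) := uniq (k.1 :: k.2.1) && uniq (k.1 :: k.2.2).
pose C (k : K) := chain_gain gam k.1 k.2.1 k.1 \o path_gain k.1 k.2.2.
pose G (k : K) := path_gain k.1 k.2.2.
have cycle_gain i p : gain (chain_gain gam i p i).
  apply: gain_eq (path_gainP i (rcons p i)) _ => s _.
  by rewrite -[rcons _ _]cats0 path_gain_rcons_cat.
have [|eta [Keta lt_eta CG]] := @common_expansion K P C G.
  move=> [i [p q]] /andP[/= up uq]; have gq := path_gainP i q.
  split; [exact: gain_comp|exact: gq|rewrite /C /G /= => r r0].
  (* Where the path gain vanishes there is no strict inequality, but the cycle then maps 0 to 0. *)
  have [q0|q0] := ltP 0 (path_gain i q r); first by left; exact: sg.
  right; rewrite (_ : path_gain i q r = 0) ?gain0//.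
  by apply/eqP; rewrite eq_le q0 gain_ge0// ltW.
have insP (p : seq I) (i : I) : uniq (i :: p) ->
    exists2 t : #|I|.-bseq I, uniq (i :: t) & p = t.
  move=> up; have sp : (size p <= #|I|)%N.
    by rewrite -(card_uniqP (andP up).2) max_card.
  by exists (Bseq sp).
pose sigma i r := \big[Num.max/0]_(p : #|I|.-bseq I | uniq (i :: p))
  path_gain i p (ladder eta (size p) r).
have sigma_ge i p r : uniq (i :: p) ->
    path_gain i p (ladder eta (size p) r) <= sigma i r.
  by move=> /insP[t ut ->]; apply: (le_bigmax_cond _ (fun t : #|I|.-bseq I => _)).
have sigma_id i r : r <= sigma i r by exact: (sigma_ge i [::]).
exists sigma => [i|i j r r0].
  apply: (@gain_Kinf _ _ 1) => //; last exact: lt_le_trans (sigma_id i 1).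
  apply: gain_bigmax => p _; apply: gain_comp; first exact: path_gainP.
  by left; exact: ladder_Kinf.
have s0 : 0 < sigma i r := lt_le_trans r0 (sigma_id i r).
have lad0 n : 0 <= ladder eta n r.
  exact: classK_ge0 (ladder_Kinf n Keta).1 _ (ltW r0).
have [E|[p up E]] := bigmax0_attained
    (fun p : #|I|.-bseq I => uniq (j :: p))
    (fun p => path_gain j p (ladder eta (size p) r)).
  by rewrite {1}/sigma E gain0.
rewrite {1}/sigma E -[gam i j _]/(path_gain i (j :: p) (ladder eta (size p) r)).
(* A path that avoids [i] remains simple when issued from [i]; being longer, it is evaluated one
   rung higher, which gives strictness. *)
have [ijp|ijp] := boolP (i \in j :: p); last first.
  have uijp : uniq (i :: j :: p) by rewrite cons_uniq ijp.
  have [Kp|zp] := path_gainP i (j :: p); last by rewrite zp.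
  apply: lt_le_trans (sigma_ge i (j :: p) r uijp).
  by have [[_ _ mono] _] := Kp; apply: mono => //; exact/ladder_ltS/lt_eta.
(* A path that meets [i] is cut there into a simple cycle at [i] and a shorter simple path. If
   [i = j], then [s1] is empty and the cycle is a loop. *)
have [s1 [s2 [Es u1 u2]]] : exists s1 s2, [/\ j :: p = rcons s1 i ++ s2,
    uniq (i :: s1) & uniq (i :: s2)].
  case/splitPr: {-1}(j :: p) / ijp (erefl (j :: p)) => s1 s2 Es.
  exists s1, s2; rewrite cat_rcons; split=> //.
    by move: up; rewrite Es cat_uniq /= => /and3P[-> /norP[is1 _] _]; rewrite andbT.
  by move: up; rewrite Es cat_uniq => /and3P[].
have [t1 ut1 Et1] := insP _ _ u1; have [t2 ut2 Et2] := insP _ _ u2.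
have Pk : P (i, (t1, t2)) by apply/andP.
have -> : path_gain i (j :: p) = C (i, (t1, t2)).
  by rewrite Es path_gain_rcons_cat Et1 Et2.
have [KC|zC] : gain (C (i, (t1, t2))) by exact: gain_comp (cycle_gain _ _) (path_gainP _ _).
  (* Strictness comes from [ladder_lt]; [CG] then removes the cycle even at the enlarged argument
     [eta r]. *)
  apply: (@lt_le_trans _ _ (path_gain i t2 r)).
    apply: lt_le_trans (CG _ Pk r (ltW r0)).
    by have [[_ _ mono] _] := KC; apply: mono => //; exact/ladder_lt/lt_eta.
  apply: le_trans (sigma_ge i t2 r ut2).
  by apply: gain_le; [exact: path_gainP|exact: ltW|exact/ladder_ge/lt_eta].
by rewrite zC.
Qed.

End small_gain.

(** * From sums to maxima *)

Section decay.
Context {R : realType}.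

(* The margin s - al s may vanish at infinity, so the bound on v is needed. *)
Lemma add_le_max (al : R -> R) (B Y : R) : classKinf al -> lt_id al ->
  exists2 g, classKinf g & forall v y, 0 <= v <= B -> 0 <= y <= Y ->
    al v + y <= Num.max (mid al id v) (g y).
Proof.
move=> Kal al_lt.
pose ale (p : R * R) := al (Num.max 0 p.1).
pose d (p : R * R) := ale p + p.2.
pose margin (p : R * R) := d p - mid al id (Num.max 0 p.1).
have c1 : continuous (fst : R * R -> R) by move=> p; exact: cvg_fst.
have c2 : continuous (snd : R * R -> R) by move=> p; exact: cvg_snd.
have cK a : classKinf a -> continuous (fun p : R * R => a (Num.max 0 p.1)).
  move=> Ka p; apply: (@cvg_comp _ _ _ fst (fun s => a (Num.max 0 s))); first exact: c1.
  exact: (classK_continuous Ka.1).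
have cd : continuous d.
  by move=> p; apply: cvgD; [exact: cK|exact: c2].
have cm : continuous margin.
  by move=> p; apply: cvgB; [exact: cd|exact: cK (Kinf_mid Kal Kinf_id) _].
(* On [A] the midpoint bound fails or is tight. At [y = 0] this forces [v <= al v], hence [v = 0],
   so on [A] the sum is controlled by [y] alone. *)
pose A := (`[0, B]%classic `*` `[0, Y]%classic) `&` [set p | 0 <= margin p].
have cA : compact A.
  apply: compact_closedI; first by apply: compact_setX; exact: segment_compact.
  have -> : [set p | 0 <= margin p] = margin @^-1` [set y | 0 <= y] by [].
  by apply: closed_comp => [x _|]; [exact: cm|exact: closed_ge].
have [||g Kg Hg] := compact_majorant cA cd c2.
- by move=> [v y] [[_ /=]]; rewrite in_itv/= => /andP[].
- move=> [v y] [[/= + _] +] /= y0; rewrite in_itv/= => /andP[v0 _].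
  rewrite /margin /d /ale /mid /= max_r// y0 addr0 => mv.
  have : ~ 0 < v by move=> /al_lt; lra.
  move/negP; rewrite -leNgt => v_le0.
  have -> : v = 0 by apply/eqP; rewrite eq_le v_le0.
  by have [[-> _ _] _] := Kal.
exists g => // v y /andP[v0 vB] /andP[y0 yY].
rewrite le_max; have [//|lt] := leP (al v + y) (mid al id v).
have Avy : A (v, y).
  split; first by split; rewrite /= in_itv/= ?v0 ?y0.
  by rewrite /margin /d /ale /= max_r// subr_ge0 ltW.
by have := Hg _ Avy; rewrite /d /ale /= max_r.
Qed.

End decay.

(** * Euclidean norm of block vectors *)

Section euclidean.
Context {R : realType}.

Lemma enorm_ge0 k (v : 'rV[R]_k) : 0 <= enorm v.
Proof. exact: sqrtr_ge0. Qed.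

Lemma enorm_sqr k (v : 'rV[R]_k) : enorm v ^+ 2 = \sum_j v 0 j ^+ 2.
Proof. by rewrite sqr_sqrtr// sumr_ge0// => j _; exact: sqr_ge0. Qed.

Lemma enorm0 k : enorm (0 : 'rV[R]_k) = 0.
Proof.
by apply/eqP; rewrite -sqrf_eq0 enorm_sqr big1// => j _; rewrite mxE expr0n.
Qed.

Lemma enorm_eq0 k (v : 'rV[R]_k) : enorm v = 0 -> v = 0.
Proof.
move=> v0; apply/rowP => j; rewrite mxE; apply/eqP; rewrite -sqrf_eq0 eq_le.
have sum0 : \sum_j v 0 j ^+ 2 = 0 by rewrite -enorm_sqr v0 expr0n.
by rewrite sqr_ge0 andbT -[leRHS]sum0 (bigD1 j)//= lerDl sumr_ge0// => i _; exact: sqr_ge0.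
Qed.

Lemma enorm_continuous k : continuous (@enorm R k).
Proof.
move=> v; apply: (@continuous_comp _ _ _ (fun v : 'rV[R]_k => \sum_j v 0 j ^+ 2)
  Num.sqrt); last exact: sqrt_continuous.
apply: continuous_big => [|j _]; first exact: add_continuous.
move=> w; have cj : w' 0 j @[w' --> w] --> w 0 j by exact: coord_continuous.
exact: (cvgM cj cj).
Qed.

Context {n : nat} {p : 'I_n -> nat}.

Lemma enorm_blocks (x : 'rV[R]_(\sum_i p i)) :
  enorm x ^+ 2 = \sum_i enorm (submxrow x i) ^+ 2.
Proof.
have sq k (v : 'rV[R]_k) : enorm v ^+ 2 = (v *m v^T) 0 0.
  by rewrite enorm_sqr mxE; apply: eq_bigr => j _; rewrite mxE.
rewrite sq -{1 2}(submxrowK x) tr_mxrow mul_mxrow_mxcol summxE.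
by apply: eq_bigr => i _; rewrite sq.
Qed.

Lemma enorm_block_le (x : 'rV[R]_(\sum_i p i)) i : enorm (submxrow x i) <= enorm x.
Proof.
rewrite -(@ler_pXn2r _ 2)// ?nnegrE ?enorm_ge0// enorm_blocks (bigD1 i)//=.
by rewrite lerDl sumr_ge0// => j _; exact: sqr_ge0.
Qed.

(** The crude factor [n.+1] exceeds the sharp square root of [n] and stays positive for [n = 0]. *)
Lemma enorm_le_blocks (x : 'rV[R]_(\sum_i p i)) m : 0 <= m ->
  (forall i, enorm (submxrow x i) <= m) -> enorm x <= n.+1%:R * m.
Proof.
move=> m0 xm.
rewrite -(@ler_pXn2r _ 2)// ?nnegrE ?enorm_ge0// ?mulr_ge0//.
rewrite enorm_blocks (@le_trans _ _ (\sum_(i < n) m ^+ 2))//.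
  by apply: ler_sum => i _; rewrite ler_pXn2r// ?nnegrE ?enorm_ge0.
rewrite sumr_const card_ord exprMn -[leLHS]mulr_natl ler_wpM2r ?sqr_ge0//.
by rewrite -natrX ler_nat (leq_trans (leqnSn n))// leq_pmulr.
Qed.

Lemma submxrow_continuous i :
  continuous (fun x : 'rV[R]_(\sum_i p i) => submxrow x i).
Proof.
move=> x U /nbhs_ballP[e /= e0 eU]; apply/nbhs_ballP; exists e => // y [e0' xy].
by apply: eU; split=> // k l; rewrite !mxE.
Qed.

End euclidean.

(** * The Lyapunov function *)

Section lyapunov.
Context {R : realType} {ell : nat} {S : network R ell}.
Variables (P : ocp_data S) (sigma : 'I_ell -> R -> R).
Hypothesis hF : assumption_F P.
Hypothesis Ksig : forall i, classKinf (sigma i).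

Let V := lyap P sigma.

Lemma lyap_ge0 x : 0 <= V x.
Proof. exact: bigmax_ge_id. Qed.

Lemma lyap_ge x i : Kinv (sigma i) (W P (submxrow x i)) <= V x.
Proof. exact: (le_bigmax _ (fun i => Kinv (sigma i) (W P (submxrow x i)))). Qed.

Lemma lyap_bounds : exists a b : R -> R, [/\ classKinf a, classKinf b &
  forall x, a (enorm x) <= V x <= b (enorm x)].
Proof.
have /choice[ab Hab] : forall i, exists ab : (R -> R) * (R -> R),
    [/\ classKinf ab.1, classKinf ab.2 &
     forall x : 'rV_(dimx S i), ab.1 (enorm x) <= W P x <= ab.2 (enorm x)].
  by move=> i; have [a [b [? ? ?]]] := F_W_bounds hF i; exists (a, b).
pose N : R := ell.+1%:R; have N0 : 0 < N by rewrite ltr0n.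
have KL i : classKinf (Kinv (sigma i) \o (ab i).1).
  by have [? _ _] := Hab i; apply: Kinf_comp => //; exact: Kinf_Kinv.
have KU i : classKinf (Kinv (sigma i) \o (ab i).2).
  by have [_ ? _] := Hab i; apply: Kinf_comp => //; exact: Kinf_Kinv.
have [a [Ka a_le _]] := Kinf_lower (@Kinf_id R) KL.
have [b Kb le_b] := Kinf_upper KU.
have KN : classKinf ( *%R N^-1) by apply: Kinf_scale; rewrite invr_gt0.
(* The largest block norm is at least [enorm x / N], whence the rescaled argument in the lower
   bound. *)
exists (a \o *%R N^-1), b; split=> //; first exact: Kinf_comp.
move=> x; apply/andP; split.
  pose m := \big[Num.max/0]_i enorm (submxrow x i).
  have m0 : 0 <= m by exact: bigmax_ge_id.
  have xm : enorm x <= N * m.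
    by apply: enorm_le_blocks => // i; exact: (le_bigmax _ (fun i => enorm _)).
  apply: (@le_trans _ _ (a m)).
    apply: classK_le Ka.1 _ _ _ _ => /=.
      by rewrite mulr_ge0 ?enorm_ge0// invr_ge0 ltW.
    by rewrite mulrC ler_pdivrMr// mulrC.
  rewrite /m; have [->|[i _ ->]] := bigmax0_attained xpredT (fun i => enorm (submxrow x i)).
    by have [[-> _ _] _] := Ka; exact: lyap_ge0.
  apply: le_trans (a_le i _) _; apply: le_trans (lyap_ge x i) => /=.
  have [[Ki _] _ /(_ (submxrow x i))/andP[lo _]] := Hab i.
  apply: classK_le (Kinf_Kinv (Ksig i)).1 _ _ _ lo.
  by apply: classK_ge0 Ki _ _; exact: enorm_ge0.
apply/bigmax_leP; split; first exact: classK_ge0 Kb.1 _ (enorm_ge0 _).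
move=> i _; apply: le_trans (le_b i _).
have [_ [Ki _] /(_ (submxrow x i))/andP[_ up]] := Hab i.
apply: le_trans (_ : Kinv (sigma i) ((ab i).2 (enorm (submxrow x i))) <= _).
  by apply: classK_le (Kinf_Kinv (Ksig i)).1 _ _ _ up; exact: F_W_ge0.
apply: classK_le (KU i).1 _ _ _ _; first exact: enorm_ge0.
exact: enorm_block_le.
Qed.

Lemma lyap_continuous : continuous V.
Proof.
apply: continuous_big => [|i _]; first exact: max_continuous.
(* As [W] is nonnegative, the inverse scaling can be replaced by its continuous extension to the
   whole line. *)
have -> : (fun x : state S => Kinv (sigma i) (W P (submxrow x i))) =
    (fun s => Kinv (sigma i) (Num.max 0 s)) \o (@W _ _ _ P i) \o
    (fun x : state S => submxrow x i).
  by apply/funext => x /=; rewrite max_r//; exact: F_W_ge0.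
move=> x; apply: continuous_comp; first exact: submxrow_continuous.
apply: continuous_comp; first exact: F_W_cont.
exact: (classK_continuous (Kinf_Kinv (Ksig i)).1).
Qed.

(** An instance of [compact_majorant] on the square of [Z]: the difference of values vanishes
    wherever the distance does. *)
Lemma lyap_modulus (Z : set (state S)) : compact Z ->
  exists2 om : R -> R, classKinf om &
    forall z z', Z z -> Z z' -> `|V z - V z'| <= om (enorm (z - z')).
Proof.
move=> cZ.
have c1 : continuous (fst : state S * state S -> state S).
  by move=> p; exact: cvg_fst.
have c2 : continuous (snd : state S * state S -> state S).
  by move=> p; exact: cvg_snd.
have [|||||om Kom Hom] := @compact_majorant R (state S * state S)%type (Z `*` Z)
    (fun p => `|V p.1 - V p.2|) (fun p => enorm (p.1 - p.2)).
- exact: compact_setX.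
- move=> p; apply: cvg_norm; apply: cvgB.
  + by apply: (@cvg_comp _ _ _ fst V); [exact: c1|exact: lyap_continuous].
  + by apply: (@cvg_comp _ _ _ snd V); [exact: c2|exact: lyap_continuous].
- move=> p; apply: (@cvg_comp _ _ _ (fun p => p.1 - p.2) (@enorm R _)).
    by apply: cvgB; [exact: c1|exact: c2].
  exact: enorm_continuous.
- by move=> p _; exact: enorm_ge0.
- move=> p _ /enorm_eq0/eqP; rewrite subr_eq0 => /eqP ->.
  by rewrite subrr normr0.
by exists om => // z z' Zz Zz'; exact: (Hom (z, z')).
Qed.

Lemma lyap_bounded (Z : set (state S)) z0 : compact Z -> Z z0 ->
  exists B, forall z, Z z -> V z <= B.
Proof.
move=> cZ Zz0; have [c _ Hc] := compact_EVT_max (ex_intro _ z0 Zz0) cZ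
  (continuous_subspaceT lyap_continuous).
by exists (V c) => z Zz; apply: Hc; exact/mem_set.
Qed.

Hypothesis sig_gam : forall i j, active P i j ->
  lt_id (Kinv (sigma i) \o gam P i j \o sigma j).

Lemma scaled_gain : exists al : R -> R, [/\ classKinf al, lt_id al &
  forall x x' : state S,
    (forall i, W P (submxrow x' i) <=
      \big[Num.max/0]_(j | active P i j) gam P i j (W P (submxrow x j))) ->
    V x' <= al (V x)].
Proof.
pose F (k : 'I_ell * 'I_ell) := Kinv (sigma k.1) \o gam P k.1 k.2 \o sigma k.2.
have gF k : gain (F k).
  apply: gain_comp; last by left.
  by apply: gain_comp; [left; exact: Kinf_Kinv|exact: F_gam].
(* The term [s / 2] keeps [al] in class K_oo even when no pair is active. *)
pose al s := Num.max (2^-1 * s) (\big[Num.max/0]_(k | active P k.1 k.2) F k s).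
have gal : gain al.
  apply: gain_max; last by apply: gain_bigmax => k _.
  by left; apply: Kinf_scale; rewrite invr_gt0.
have al_half s : 2^-1 * s <= al s by rewrite le_max lexx.
have Kal : classKinf al.
  apply: (@gain_Kinf _ _ 1) => //.
  by apply: lt_le_trans (al_half 1); rewrite mulr1 invr_gt0.
exists al; split=> //.
  move=> s s0; rewrite gt_max; apply/andP; split; first by lra.
  by apply/bigmax_ltP; split=> // k ak; exact: sig_gam ak _ s0.
move=> x x' Hx; apply/bigmax_leP.
split=> [|i _]; first exact: gain_ge0 gal _ (lyap_ge0 x).
have W0 (j : 'I_ell) (y : state S) : 0 <= W P (submxrow y j) by exact: F_W_ge0.
have KK := (Kinf_Kinv (Ksig i)).1.
apply: le_trans (classK_le KK (W0 _ _) (Hx i)) _.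
have [->|[j aij ->]] := bigmax0_attained (fun j => active P i j)
    (fun j => gam P i j (W P (submxrow x j))).
  by have [-> _ _] := KK; exact: gain_ge0 gal _ (lyap_ge0 x).
rewrite -{1}(KinvK (Ksig j) (W0 j x)).
apply: (@le_trans _ _ (F (i, j) (V x))).
  apply: (@gain_le _ (F (i, j))) => //; last exact: lyap_ge.
  exact: Kinv_ge0.
rewrite le_max; apply/orP; right.
exact: (@le_bigmax_cond _ _ _ _ (i, j) (fun k => active P k.1 k.2) (fun k => F k (V x))).
Qed.

End lyapunov.

(** * Deviation from the nominal prediction *)

Section deviation.
Context {R : realType} {ell : nat} {S : network R ell}.
Variables (P : ocp_data S) (C : signals S).
Local Notation M := (hor P).
Hypothesis hF : assumption_F P.
Hypothesis hL : lipschitz S (L1 P) (L2 P) (L3 P).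
Hypothesis hx0 : Xset (st C 0).
Hypothesis hC : closed_loop P C.

Let M_gt1 : (1 < M)%N := F_hor hF.

Lemma ustar_in i t l : (l < M)%N -> Uc (ustar C i t l).
Proof. by move=> lM; have [[_ H _ _ _ _ _] _] := cl_opt hC i t; exact: H. Qed.

(** The ball contains 0, so the eroded constraint implies the constraint itself. *)
Lemma xnomstar_in i t l : (0 < l < M)%N -> Xc (xnomstar C i t l).
Proof.
move=> lM; have [[_ _ _ rge0 Hx _ _] _] := cl_opt hC i t.
have := Hx l lM 0; rewrite addr0; apply.
by rewrite /eball /= enorm0 rge0.
Qed.

Lemma xbarN0 i t : @xbarN _ _ _ C i t 0 = at_nbr i (fun j => xst C j t).
Proof.
by apply: functional_extensionality_dep => j; rewrite /xbarN /at_nbr (cl_xbar0 hC).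
Qed.

Lemma xst_succ i t :
  xst C i t.+1 = dyn (xst C i t) (at_nbr i (fun j => xst C j t)) (ustar C i t 0).
Proof. by rewrite /xst (cl_dyn hC) /gmap mxrowK /uapp mxrowK. Qed.

(** Packets at index 0 carry the measured states, so the true successor is the first nominal
    prediction, which is constrained because [1 < M]. *)
Lemma st_in t : Xset (st C t).
Proof.
case: t => [//|t] i; rewrite -[submxrow _ i]/(xst C i t.+1) xst_succ -xbarN0.
exact: (@xnomstar_in i t 1).
Qed.

Lemma uapp_in t : Uset (uapp C t).
Proof. by move=> i; rewrite mxrowK; apply: ustar_in; exact: ltnW. Qed.

(** Induction on [l]: of the one-step mismatch, the budget is absorbed by the radius recursion and
    what exceeds it by [sdev]. *)
Lemma deviation_le i t l : (l <= M)%N ->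
  enorm (xst C i (t + l) - xnomstar C i t l) <= rstar C i t l + sdev P C i t l.
Proof.
have [[dom _ r0 _ _ rstep _] _] := cl_opt hC i t.
elim: l => [|l IH] lM.
  by rewrite addn0 subrr enorm0 r0 addr0.
(* The constraints on the radii stop at [M - 1]; the last step uses the equation defining [rstar] at
   [M]. *)
have rle : L1 P i * rstar C i t l + budget P C i t l <= rstar C i t l.+1.
  move: (lM); rewrite leq_eqVlt => /predU1P[lM'|]; last exact: rstep.
  by rewrite lM' (cl_rstarM hC) -lM'.
have [L1_gt0 _ _ lip] := hL i.
have {}IH := IH (ltnW lM).
rewrite addnS xst_succ.
rewrite -[xnomstar C i t l.+1]/(dyn (xnomstar C i t l) (@xbarN _ _ _ C i t l) (ustar C i t l)).
(* Index 0 is not constrained by the optimal control problem; there [st_in] takes over. *)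
have xN_in : Xc (xnomstar C i t l).
  case: (posnP l) => [->|l0]; first exact: st_in.
  by apply: xnomstar_in; rewrite l0.
have xb_in : XcN (@xbarN _ _ _ C i t l).
  case: (posnP l) => [->|l0]; last by apply: dom; rewrite l0.
  by rewrite xbarN0 => j; exact: st_in.
apply: le_trans (lip _ _ _ _ _ _ _ _ _ _ _ _) _ => //.
- exact: st_in.
- by move=> j; exact: st_in.
- by apply: ustar_in; exact: ltnW.
- exact: ustar_in.
rewrite -[nbdist _ _]/(mismatch_p C i t l) -[enorm (ustar C _ _ _ - _)]/(mismatch_u C i t l).
have exc : L2 P i * mismatch_p C i t l + L3 P i * mismatch_u C i t l -
    budget P C i t l <= excess P C i t l by rewrite /excess le_max lexx.
have := ler_wpM2l (ltW L1_gt0) IH; rewrite mulrDr /=; lra.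
Qed.

Lemma terminal_deviation_le t :
  enorm (st C (t + M) - \mxrow_i xnomstar C i t M) <= ell.+1%:R * rho P C t.
Proof.
apply: enorm_le_blocks; first exact: bigmax_ge_id.
move=> i; rewrite submxrowB mxrowK.
apply: le_trans (deviation_le i t (leqnn M)) _.
exact: (le_bigmax _ (fun i => rstar C i t M + sdev P C i t M)).
Qed.

End deviation.

(** * Invariance and decrease along the closed loop *)

Theorem proposition4 (R : realType) (ell : nat) (S : network R ell)
    (P : ocp_data S) (C : signals S) (Z : set (state S))
    (hS : standing S)
    (hF : assumption_F P)
    (hL : lipschitz S (L1 P) (L2 P) (L3 P))
    (hlam : 0 < lam P)
    (hx0 : Xset (st C 0))
    (hC : closed_loop P C)
    (hfeas : recursively_feasible P C)
    (hZ : compact Z)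
    (hZx : forall t, Z (st C t))
    (hZnom : forall t l, (l <= hor P)%N -> Z (\mxrow_i xnomstar C i t l)) :
  (forall t, Xset (st C t) /\ Uset (uapp C t)) /\
  exists sigma : 'I_ell -> R -> R,
    [/\ forall i, classKinf (sigma i),
        forall i j, active P i j ->
          lt_id (Kinv (sigma i) \o gam P i j \o sigma j),
        exists alow aup omega : R -> R,
          [/\ classKinf alow, classKinf aup, classKinf omega,
              forall x : state S,
                alow (enorm x) <= lyap P sigma x <= aup (enorm x)
            & forall z z' : state S, Z z -> Z z' ->
                `|lyap P sigma z - lyap P sigma z'| <= omega (enorm (z - z'))]
      & exists ahat ghat : R -> R,
          [/\ classKinf ahat, classKinf ghat, lt_id ahat
            & forall t, lyap P sigma (st C (t + hor P)%N) <=
                Num.max (ahat (lyap P sigma (st C t))) (ghat (rho P C t))]].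
Proof.
split; first by move=> t; split; [exact: (st_in hF hx0 hC)|exact: (uapp_in hF hC)].
have [sigma Ksig gam_sig] := small_gain_scaling (F_gam hF) (F_small_gain hF).
have sig_gam i j : active P i j ->
    lt_id (Kinv (sigma i) \o gam P i j \o sigma j).
  move=> _ r r0 /=; apply: Kinv_lt => //; [|exact: ltW|exact: gam_sig].
  apply: gain_ge0 (F_gam hF i j) _ _; exact: classK_ge0 (Ksig j).1 _ (ltW r0).
have [om Kom Hom] := lyap_modulus hF Ksig hZ.
exists sigma; split=> //.
  have [a [b [Ka Kb Hab]]] := lyap_bounds hF Ksig.
  by exists a, b, om.
have [al [Kal al_lt Hal]] := scaled_gain hF Ksig sig_gam.
have [B HB] := lyap_bounded hF Ksig hZ (hZx 0%N).
have [g Kg Hg] := add_le_max B B Kal al_lt.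
have KN : classKinf ( *%R (ell.+1%:R : R)) by exact: Kinf_scale.
(* Half of the margin [s - al s] is spent on turning the sum into a maximum; [ell.+1] is the cost of
   passing from blocks to the full vector. *)
exists (mid al id), (g \o (om \o *%R ell.+1%:R)); split.
- exact: Kinf_mid Kal (@Kinf_id R).
- by apply: Kinf_comp => //; exact: Kinf_comp.
- by move=> s s0; have := al_lt s s0; rewrite /mid; lra.
move=> t; set V := lyap P sigma.
pose x' := \mxrow_i xnomstar C i t (hor P).
pose y := om (ell.+1%:R * rho P C t).
have V0 z : 0 <= V z by exact: lyap_ge0.
have y0 : 0 <= y.
  by apply: classK_ge0 Kom.1 _ _; rewrite mulr_ge0//; exact: bigmax_ge_id.
have B0 : 0 <= B by exact: le_trans (V0 _) (HB _ (hZx 0%N)).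
have Vx' : V x' <= al (V (st C t)).
  apply: Hal => i; rewrite mxrowK.
  by have [[_ _ _ _ _ _ Hter] _] := cl_opt hC i t.
have Vy : V (st C (t + hor P)%N) - V x' <= y.
  have := Hom _ _ (hZx (t + hor P)%N) (hZnom t _ (leqnn _)).
  move/(le_trans (ler_norm _))/le_trans; apply.
  apply: classK_le Kom.1 _ _ (enorm_ge0 _) _; exact: terminal_deviation_le.
(* No bound on [rho] is available, but the increase of [V] cannot exceed its bound [B] on [Z].
   Capping [y] at [B] brings it into the range where [g] is valid. *)
apply: (@le_trans _ _ (al (V (st C t)) + Num.min y B)).
  rewrite -lerBlDl le_min; apply/andP; split; first by lra.
  have := HB _ (hZx (t + hor P)%N); have := V0 x'; rewrite -/V; lra.
have minB : 0 <= Num.min y B <= B by rewrite le_min y0 B0 ge_min lexx orbT.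
have /andP[min0 _] := minB.
apply: le_trans (Hg (V (st C t)) _ _ minB) _; first by rewrite V0 HB.
rewrite ge_max !le_max lexx /=; apply/orP; right.
by apply: classK_le Kg.1 _ _ min0 _; rewrite ge_min lexx.
Qed.
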